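(* Let $\mathcal{D}=\langle \mathcal{N},\mathcal{E},\mathscr{T},c,v\rangle$ be a path-planning domain with visibility constraints in which all edges are undirected, i.e. $(i,j)\in\mathcal{E}\Rightarrow(j,i)\in\mathcal{E}$, and let $k,m\in\mathbb{Z}_{>0}$. If for all $s,g\in\mathcal{N}$ and any $t\in\mathscr{T}$ there exists a path from $s$ to $g$ covering $t$, then the Clustering-based Planner (Cbp) satisfies $(k,0,m)$-Anonymity for $\mathcal{D}$.
   Context: Domain: $\mathcal{N}$ is a non-empty set of nodes, $\mathcal{E}\subseteq\mathcal{N}\times\mathcal{N}$ a set of edges without self-loops, $\mathscr{T}\subseteq\mathcal{N}$ the transit candidates, $c:\mathcal{E}\to\mathbb{R}_{\ge 0}$ the edge cost, $v:\mathcal{N}\to 2^{\mathcal{N}}$ the visibility function; $v^{-1}(u)$ is the set of nodes from which $u$ is visible. A path $\pi=n_1,\dots,n_{|\pi|}$ is a sequence of nodes with $(n_i,n_{i+1})\in\mathcal{E}$ (nodes may repeat), $|\pi|$ is its number of nodes; its cost is the sum of its edge costs; it covers a node $n$ if $n\in v(n_i)$ for some $i$. $d(a,b)$ is the minimum cost of a path from $a$ to $b$, with the convention $d(a,a)=\infty$. $\pi|_m$ is the sequence of the first $m$ nodes of $\pi$, with $\pi|_m=\pi$ if $m>|\pi|$. $\pi_a\circ\pi_b$ is the concatenation of two paths where the last node of $\pi_a$ equals the first node of $\pi_b$ (that node appears once). Planner: a path planner $\mathcal{A}$ maps a tuple $\langle\mathcal{D},s,g,t\rangle$ ($s,g\in\mathcal{N}$,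 $t\in\mathscr{T}$) to a path from $s$ to $g$ covering $t$, or to Failure; by convention Failure $\ne$ Failure. Anonymity: for $s\ne t$, $g\ne t$, the path $\mathcal{A}(\langle\mathcal{D},s,g,t\rangle)$ is a $(k,\ell,m)$-Anonymized Path with respect to $t$ if there is a set $T\subseteq\{t'\in\mathscr{T} : \mathcal{A}(\langle\mathcal{D},s,g,t\rangle)|_m=\mathcal{A}(\langle\mathcal{D},s,g,t'\rangle)|_m\}$ with $|T|\ge k$ and $\min_{(i,j)\in T\times T}d(i,j)\ge\ell$. A tuple $\langle\mathcal{D},s,g,t\rangle$ with $s\neq t$, $g\neq t$ is a $(k,\ell,m)$-Anonymizable Tuple if there is some path planner $\mathcal{A}$ for which such a $T$ exists. A planner satisfies $(k,\ell,m)$-Anonymity for $\mathcal{D}$ if it returns a $(k,\ell,m)$-Anonymized Path for all $(k,\ell,m)$-Anonymizable Tuples in $\mathcal{D}$. Clustering-based Planner (Cbp): the centroid of $\mathcal{U}\subseteq\mathcal{N}$ is a node $\sigma\in\arg\min_{n\in\mathcal{N}}\max_{u\in\mathcal{U}}\min_{w\in v^{-1}(u)}d(n,w)$. (i) Randomly assign the transit candidates to $[|\mathscr{T}|/k]$ clusters, each with at least $k$ nodes. (ii) Repeat until the assignment does not change: assign each transit candidate to the cluster with the nearest centroid, then recompute the centroids. (iii) While some cluster has fewer than $k$ nodes, move all elements of each such cluster to the nearest cluster (distance between clusters is the shortest distance between their centroids). (iv) Let $\sigma_t$ be the centroid of the cluster containing $t$ and $\pi^*_{a\to\sigma_t}$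 the shortest path from $a$ to $\sigma_t$. If $|\pi^*_{s\to\sigma_t}|\ge m$, let $\pi^1=\pi^*_{s\to\sigma_t}|_m$. Otherwise start with $r=s$ and the path $\pi_{s\to r}=s$, and while $|\pi_{s\to r}|+|\pi^*_{r\to\sigma_t}|<m$ replace $r$ by a randomly picked neighbor of $r$ and append it to $\pi_{s\to r}$; then let $\pi^1=\pi_{s\to r}\circ\pi^*_{r\to\sigma_t}$. (v) Let $\pi^2$ be the shortest path from the last node of $\pi^1$ to $g$ covering $t$; return $\pi^1\circ\pi^2$. The clustering and the random choices are such that the first $m$ nodes of the output are the same for all transit points belonging to the same cluster (for given $\mathcal{D},s,g$). *)

(* Defs.v *)
From HB Require Import structures.
From mathcomp Require Import boolp classical_sets reals constructive_ereal ereal.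
From mathcomp Require Import all_boot all_order all_algebra.
(* Restores the finite-set names (set0, setX, ...) hidden by classical_sets. *)
Import finset.

Set Implicit Arguments.
Unset Strict Implicit.
Unset Printing Implicit Defensive.

Import Order.TTheory GRing.Theory Num.Theory.
Local Open Scope ring_scope.

(* Only the values of [cost] on edges matter. *)
Record domain (R : realType) := Domain {
  node : finType;
  node_gt0 : (0 < #|node|)%N;
  edge : rel node;
  edge_irrefl : irreflexive edge;
  transit : {set node};
  cost : node -> node -> R;
  cost_ge0 : forall i j, edge i j -> 0 <= cost i j;
  vis : node -> {set node}
}.

Definition cand (R : realType) (D : domain R) : finType :=
  {t : node D | t \in transit D}.

Section Paths.
Context (R : realType) (D : domain R).
Implicit Types (a b n s g u : node D) (p q : seq (node D)).

(* [p] is a non-empty sequence of nodes following edges from [a] to [b];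
   the length |p| is [size p], and the prefix of length m is [take m p]. *)
Definition path_between a b p : bool :=
  if p is x :: p' then [&& x == a, path (@edge R D) x p' & last x p' == b]
  else false.

Definition path_cost p : R := \sum_(e <- zip p (behead p)) cost e.1 e.2.

Definition covers p n : bool := has (fun x => n \in vis x) p.

(* The infimum is attained: [node D] is finite and costs are nonnegative.
   It is +oo when [b] cannot be reached from [a]; d(a, a) = +oo is a convention,
   which makes a separation condition on a set ignore its diagonal. *)
Definition dist a b : \bar R :=
  if a == b then +oo%E
  else ereal_inf [set (path_cost p)%:E | p in [set p | path_between a b p]]%classic.

(* Concatenation of paths, for [last _ p = head _ q]. *)
Definition join p q := p ++ behead q.

Definition cheapest (P : pred (seq (node D))) (o : option (seq (node D))) : Prop :=
  if o is Some p then P p /\ (forall q, P q -> path_cost p <= path_cost q)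
  else forall q, ~~ P q.

Definition covering_path s g u : pred (seq (node D)) :=
  fun p => path_between s g p && covers p u.

End Paths.

Section Anonymity.
Context (R : realType) (D : domain R).

(* [None] is Failure. *)
Definition planner := node D -> node D -> cand D -> option (seq (node D)).

Definition path_planner (A : planner) : Prop :=
  forall s g t p, A s g t = Some p -> covering_path s g (val t) p.

(* Failure is different from itself, hence the [false] case. *)
Definition same_prefix (m : nat) (o o' : option (seq (node D))) : bool :=
  if (o, o') is (Some p, Some p') then take m p == take m p' else false.

Definition anonymized (k : nat) (l : R) (m : nat) (A : planner)
    (s g : node D) (t : cand D) : Prop :=
  [/\ s != val t, g != val t &
   exists T : {set cand D},
     [/\ T \subset [set t' | same_prefix m (A s g t) (A s g t')],
         (k <= #|T|)%N &
         (l%:E <= \big[Order.min/+oo]_(ij in setX T T)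
                    dist (val ij.1) (val ij.2))%E]].

Definition anonymizable (k : nat) (l : R) (m : nat)
    (s g : node D) (t : cand D) : Prop :=
  exists2 A : planner, path_planner A & anonymized k l m A s g t.

Definition satisfies_anonymity (k : nat) (l : R) (m : nat) (A : planner) : Prop :=
  path_planner A /\
  forall s g t, anonymizable k l m s g t -> anonymized k l m A s g t.

End Anonymity.

Section Clustering.
Context (R : realType) (D : domain R).

(* min over v^-1(u) of d(n, _). *)
Definition reach (n u : node D) : \bar R :=
  \big[Order.min/+oo%E]_(w | u \in vis w) dist n w.

Definition radius (U : {set node D}) (n : node D) : \bar R :=
  \big[Order.max/-oo%E]_(u in U) reach n u.

Definition is_centroid (U : {set node D}) (c : node D) : Prop :=
  forall n, (radius U c <= radius U n)%E.

(* [ctr] picks, for each set of nodes, one of its centroids. *)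
Context (k : nat) (ctr : {set node D} -> node D).

Definition nclusters : nat := #|transit D| %/ k.

Definition assignment := {ffun cand D -> 'I_nclusters}.

Definition cluster (a : assignment) (i : 'I_nclusters) : {set node D} :=
  [set val t | t in [set t | a t == i]].

(* A label with an empty class is not a cluster any more: it has no centroid to
   be compared with, and nothing can be moved into it. *)

(* The distance from a centroid to a candidate is [reach], the one that centroids
   minimize. *)
Definition reassign (a a' : assignment) : bool :=
  [forall t, (cluster a (a' t) != set0) &&
    [forall i, (cluster a i != set0) ==>
      (reach (ctr (cluster a (a' t))) (val t)
         <= reach (ctr (cluster a i)) (val t))%E]].

(* An undersized cluster [i] is moved as a whole into the nearest cluster [j].
   Undersized clusters are moved one at a time: moving two of them
   simultaneously could merely swap them. *)
Definition merge (a a' : assignment) : bool :=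
  [exists i, exists j,
    [&& (0 < #|cluster a i| < k)%N, j != i, cluster a j != set0,
        [forall h, ((h != i) && (cluster a h != set0)) ==>
          (dist (ctr (cluster a i)) (ctr (cluster a j))
             <= dist (ctr (cluster a i)) (ctr (cluster a h)))%E] &
        a' == [ffun t => if a t == i then j else a t]]].

(* [a] is a possible result of the clustering steps: a random assignment [a0] is
   updated until it is stable, giving [a1]; then undersized clusters are merged
   until there are none. *)
Definition clustering (a : assignment) : Prop :=
  exists a0 a1 : assignment,
    [/\ forall i, (k <= #|cluster a0 i|)%N,
        connect reassign a0 a1 /\ reassign a1 a1,
        connect merge a1 a &
        forall i, cluster a i != set0 -> (k <= #|cluster a i|)%N].

End Clustering.

Section Query.
Context (R : realType) (D : domain R) (m : nat).

(* [sp a b] is the shortest path from [a] to [b]; [spc a b u] is the shortest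
   one covering [u]; [None] when there is no such path. *)
Context (sp : node D -> node D -> option (seq (node D))).
Context (spc : node D -> node D -> node D -> option (seq (node D))).

(* Values taken by the path from [s] to r in the random extension loop. *)
Inductive wander (s c : node D) : seq (node D) -> Prop :=
| wander_start : wander s c [:: s]
| wander_step q p r : wander s c q -> sp (last s q) c = Some p ->
    (size q + size p < m)%N -> edge (last s q) r -> wander s c (rcons q r).

(* Possible outcomes of the construction of the first part of the path, from [s]
   and towards the centroid [c]. *)
Inductive first_part (s c : node D) : option (seq (node D)) -> Prop :=
| first_unreachable : sp s c = None -> first_part s c None
| first_truncated p : sp s c = Some p -> (m <= size p)%N ->
    first_part s c (Some (take m p))
| first_extended p0 q p : sp s c = Some p0 -> (size p0 < m)%N ->
    wander s c q -> sp (last s q) c = Some p -> (m <= size q + size p)%N ->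
    first_part s c (Some (join q p))
| first_lost p0 q : sp s c = Some p0 -> (size p0 < m)%N ->
    wander s c q -> sp (last s q) c = None -> first_part s c None
| first_stuck p0 q p : sp s c = Some p0 -> (size p0 < m)%N ->
    wander s c q -> sp (last s q) c = Some p -> (size q + size p < m)%N ->
    (forall r, ~~ edge (last s q) r) -> first_part s c None.

Definition second_part (s g u : node D) (o : option (seq (node D))) :
    option (seq (node D)) :=
  if o is Some p1 then
    if spc (last s p1) g u is Some p2 then Some (join p1 p2) else None
  else None.

Definition query (c s g u : node D) (o : option (seq (node D))) : Prop :=
  exists2 o1, first_part s c o1 & o = second_part s g u o1.

End Query.

(* [A] is a possible input-output behaviour of the randomized clustering-based
   planner with parameters [k] and [m]: [ctr], [sp] and [spc] break the ties, and
   the clustering may be run afresh for each pair of endpoints. With fewer than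
   [k] transit candidates there are no clusters at all.
   The last clause constrains the random choices: whenever it returns paths, the
   planner shows the same [m] first nodes for all the candidates of a cluster. It
   does not follow from the rest, because [join q p] in [first_extended] may have
   only [m - 1] nodes. *)
Definition cbp (R : realType) (D : domain R) (k m : nat) (A : planner D) : Prop :=
  exists (ctr : {set node D} -> node D)
         (sp : node D -> node D -> option (seq (node D)))
         (spc : node D -> node D -> node D -> option (seq (node D))),
  [/\ forall U, is_centroid U (ctr U),
      forall a b, cheapest (path_between a b) (sp a b),
      forall a b u, cheapest (covering_path a b u) (spc a b u) &
      if (#|transit D| < k)%N then forall s g t, A s g t = None
      else forall s g, exists a : assignment D k,
        [/\ clustering ctr a,
            forall t, query m sp spc (ctr (cluster a (a t))) s g (val t) (A s g t) &
            forall t t' p p', a t = a t' ->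
              A s g t = Some p -> A s g t' = Some p' -> take m p = take m p']].

(* Main.v *)
Require Import Defs.
From mathcomp Require Import boolp classical_sets reals constructive_ereal ereal.
From mathcomp Require Import all_boot all_order all_algebra.
Import finset.

Set Implicit Arguments.
Unset Strict Implicit.
Unset Printing Implicit Defensive.

Import Order.TTheory GRing.Theory Num.Theory.

(* In a feasible domain every shortest path the planner asks for exists, and a
   node without neighbours would be the only node, so the random walk never gets
   stuck: the planner never fails.  The cluster of [t] then has at least [k]
   elements, all of which share the first [m] nodes of the output; separation by
   0 is free because distances are nonnegative. *)

Section Paths.
Context (R : realType) (D : domain R).
Implicit Types (a b c n s g u : node D) (p q : seq (node D)).

Lemma path_between_last n a b p : path_between a b p -> last n p = b.
Proof. by case: p => // x p /and3P[_ _ /eqP]. Qed.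

(** The bound [0 < m] matters: the empty prefix is not a path. *)
Lemma path_between_take m a b p : (0 < m)%N -> path_between a b p ->
  path_between a (last a (take m p)) (take m p).
Proof.
case: m p => [//|m] [//|x p] _ /and3P[/eqP<- xp _] /=.
by rewrite !eqxx take_path.
Qed.

Lemma path_between_join a b c p q :
  path_between a b p -> path_between b c q -> path_between a c (join p q).
Proof.
case: p q => [//|x p] [//|y q] /and3P[xa xp /eqP pb] /and3P[/eqP-> yq qc].
by rewrite /join /= xa cat_path last_cat xp pb yq.
Qed.

Lemma path_between_rcons a b c p : path_between a b p -> edge b c ->
  path_between a c (rcons p c).
Proof.
case: p => [//|x p] /and3P[xa xp /eqP pb] bc /=.
by rewrite xa rcons_path xp pb bc last_rcons eqxx.
Qed.

Lemma path_between_edge a b p : path_between a b p -> a != b ->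
  exists r, edge a r.
Proof.
case: p => [//|x [|y p]] /and3P[/eqP-> /=]; first by move=> _ /eqP->; rewrite eqxx.
by case/andP=> ay _ _ _; exists y.
Qed.

Lemma covers_join a b c u p q : path_between a b p -> path_between b c q ->
  covers q u -> covers (join p q) u.
Proof.
case: p q => [//|x p] [//|y q] /and3P[_ _ /eqP pb] /and3P[/eqP-> _ _].
rewrite /covers /join has_cat /= => /orP[bu|->]; last by rewrite orbT.
(* [join] drops the head of the second path; if [u] is seen from there, it is also seen from the
   last node of the first path, which is the same node. *)
apply/orP; left; rewrite -[_ || _]/(has _ (x :: p)).
by apply/hasP; exists b => //; rewrite -pb mem_last.
Qed.

Lemma path_cost_ge0 a b p : path_between a b p -> (0 <= path_cost p)%R.
Proof.
case: p => [//|x p] /and3P[_ + _]; rewrite /path_cost /= => {a b}.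
elim: p x => [|y p IHp] x /=; first by rewrite big_nil.
by case/andP=> xy yp; rewrite big_cons addr_ge0 ?cost_ge0 ?IHp.
Qed.

Lemma dist_ge0 a b : (0%:E <= dist a b)%E.
Proof.
rewrite /dist; case: ifP => _; first exact: leey.
apply: le_ereal_inf_tmp => _ [p pab <-].
by rewrite lee_fin (path_cost_ge0 pab).
Qed.

End Paths.

Section Planner.
Context (R : realType) (D : domain R) (m : nat).
Context (sp : node D -> node D -> option (seq (node D))).
Context (spc : node D -> node D -> node D -> option (seq (node D))).
Hypothesis m_gt0 : (0 < m)%N.
Hypothesis spP : forall a b, cheapest (path_between a b) (sp a b).
Hypothesis spcP : forall a b u, cheapest (covering_path a b u) (spc a b u).

Lemma sp_path a b p : sp a b = Some p -> path_between a b p.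
Proof. by move=> ab; have := spP a b; rewrite ab => -[]. Qed.

Lemma spc_path a b u p : spc a b u = Some p -> covering_path a b u p.
Proof. by move=> abu; have := spcP a b u; rewrite abu => -[]. Qed.

Lemma wander_path s c q : wander m sp s c q -> path_between s (last s q) q.
Proof.
elim=> [|{}q p r _ sq _ _ qr]; first by rewrite /= !eqxx.
by rewrite last_rcons; apply: path_between_rcons qr.
Qed.

Lemma first_part_path s c p :
  first_part m sp s c (Some p) -> path_between s (last s p) p.
Proof.
move Eo: (Some p) => o H; case: H Eo => //.
- by move=> p0 sc _ [->]; apply: path_between_take (sp_path sc).
- move=> p0 q p1 _ _ /wander_path sq /sp_path qc _ [->].
  have sc := path_between_join sq qc.
  by rewrite (path_between_last s sc).
Qed.

Lemma query_path c s g u p :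
  query m sp spc c s g u (Some p) -> covering_path s g u p.
Proof.
case=> -[p1|//] /first_part_path sp1 /=.
case E: (spc _ _ _) => [p2|//] [->]; have /andP[p2g p2u] := spc_path E.
by rewrite /covering_path (path_between_join sp1 p2g) (covers_join sp1 p2g p2u).
Qed.

(** Two distinct nodes are required: a domain with one node can be feasible, but it has no edge, so
    for [m] at least 3 the random walk would be stuck at once. *)
Lemma query_success c s g u o :
  (exists n n' : node D, n != n') ->
  (forall a b : node D, exists p, covering_path a b u p) ->
  query m sp spc c s g u o -> exists p, o = Some p.
Proof.
move=> [n [n' nn']] ex.
have conn (a b : node D) : exists p, path_between a b p.
  by have [p /andP[abp _]] := ex a b; exists p.
have sp_some (a b : node D) : sp a b <> None.
  move=> ab; have := spP a b; rewrite ab /= => none.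
  by have [p abp] := conn a b; have := none p; rewrite abp.
have spc_some (a b : node D) : exists p, spc a b u = Some p.
  case E: (spc a b u) => [p|]; first by exists p.
  have := spcP a b u; rewrite E /= => none.
  by have [p abp] := ex a b; have := none p; rewrite abp.
have has_edge (a : node D) : exists r, edge a r.
  have [b ab] : exists b : node D, a != b.
    by have [->|an] := eqVneq a n; [exists n' | exists n].
  (* A path to a node other than [a] must begin with an edge out of [a]. *)
  by have [p abp] := conn a b; apply: path_between_edge abp ab.
case=> o1 H ->; case: o1 / H => [/sp_some //|p _ _|p0 q p _ _ _ _ _|
    p0 q _ _ _ /sp_some //|p0 q p _ _ _ _ _ stuck] /=; last first.
- by have [r qr] := has_edge (last s q); have := stuck r; rewrite qr.
(* In the truncated and extended cases, the second part exists from whichever node [b] the first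
   part ends at. *)
all: by move: (last s _) => b; have [p2 ->] := spc_some b g; eexists.
Qed.

End Planner.

Lemma card_cand (R : realType) (D : domain R) : #|cand D| = #|transit D|.
Proof. by rewrite card_sig; apply: eq_card => t. Qed.

(** Clusters are sets of nodes, whereas an anonymity set consists of candidates; injectivity of
    [val] transfers size bounds between them. *)
Lemma card_cluster (R : realType) (D : domain R) k (a : assignment D k) i :
  #|Defs.cluster a i| = #|[set t | a t == i]|.
Proof. exact: card_imset val_inj. Qed.

Lemma anonymized0 (R : realType) (D : domain R) k m (A : planner D) s g t
    (T : {set cand D}) :
  s != val t -> g != val t ->
  {subset T <= [pred t' | same_prefix m (A s g t) (A s g t')]} ->
  (k <= #|T|)%N -> anonymized k 0%R m A s g t.
Proof.
move=> st gt Tsub kT; split=> //; exists T; split=> //.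
  by apply/subsetP => t' /Tsub; rewrite inE.
(* Being at least 0 holds for the default [+oo] (the value for empty [T]) and for every distance,
   and is preserved by [min]. *)
elim/big_ind: _ => [|x y x0 y0|ij _]; [exact: leey| |exact: dist_ge0].
by rewrite le_min x0.
Qed.

Theorem proposition5 (R : realType) (D : domain R) (k m : nat)
    (k_gt0 : (0 < k)%N) (m_gt0 : (0 < m)%N)
    (undirected : forall i j : node D, edge i j -> edge j i)
    (feasible : forall (s g : node D) (t : cand D),
       exists p : seq (node D), path_between s g p /\ covers p (val t)) :
  forall A : planner D, cbp k m A -> satisfies_anonymity k 0%R m A.
Proof.
move=> A [ctr [sp [spc [_ spP spcP]]]]; case: ltnP => [Tk fail|_ run].
  (* With fewer than [k] candidates no tuple is anonymizable, for any planner [B]: the set [T] would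
     be too large. *)
  split=> [s g t p|s g t [B _ [_ _ [T [_ kT _]]]]]; first by rewrite fail.
  have := leq_trans kT (max_card T).
  by rewrite card_cand leqNgt Tk.
split=> [s g t p Ap|s g t [_ _ [st gt _]]].
  have [a [_ /(_ t) + _]] := run s g; rewrite Ap.
  exact: query_path.
have [a [[_ [_ [_ _ _ large]]] qA same]] := run s g.
have some t' : exists p, A s g t' = Some p.
  (* The endpoints condition [s != val t] supplies the two distinct nodes. *)
  apply: query_success (qA t') => //; first by exists s, (val t).
  move=> x y; have [p [xy pt]] := feasible x y t'.
  by exists p; apply/andP.
(* The anonymity set is the whole cluster of [t]. *)
apply: (@anonymized0 _ _ _ _ _ _ _ _ [set t' | a t' == a t]) => // [t'|].
  rewrite !inE => /eqP att'; have [[p Ap] [p' Ap']] := (some t, some t').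
  by rewrite Ap Ap' /same_prefix (same _ _ _ _ (esym att') Ap Ap').
(* Only nonempty clusters are known to have [k] elements after merging; this one contains [t]. *)
rewrite -card_cluster; apply: large.
by rewrite -card_gt0 card_cluster; apply/card_gt0P; exists t; rewrite inE.
Qed.
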